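(* $\operatorname{non}(\mathcal E)\le\operatorname{non}^*(\mathcal Z)$ and $\operatorname{cov}^*(\mathcal Z)\le\operatorname{cov}(\mathcal E)$. Also, $\operatorname{cov}^*(\mathcal Z)\le\operatorname{non}^*(\mathcal Z)$.
   Context: $\mathcal Z=\{A\subseteq\omega:\lim_{n\to\infty}|A\cap n|/n=0\}$ is the asymptotic density zero ideal on $\omega$. $\mathcal E$ is the $\sigma$-ideal on $2^\omega$ generated by the closed Lebesgue null sets; $\operatorname{non}(\mathcal E)$ is the least size of a subset of $2^\omega$ not in $\mathcal E$ and $\operatorname{cov}(\mathcal E)$ is the least size of a subfamily of $\mathcal E$ covering $2^\omega$. For an ideal $\mathscr I$ on $\omega$: $\operatorname{non}^*(\mathscr I)=\min\{|\mathcal A|:\mathcal A\subseteq[\omega]^\omega,\ \forall B\in\mathscr I\,\exists A\in\mathcal A\ |A\cap B|<\omega\}$ and $\operatorname{cov}^*(\mathscr I)=\min\{|\mathcal A|:\mathcal A\subseteq\mathscr I,\ \forall B\in[\omega]^\omega\,\exists A\in\mathcal A\ |A\cap B|=\omega\}$. *)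

(* Defs.v *)
From HB Require Import structures.
From mathcomp Require Import all_boot all_order all_algebra finmap.
From mathcomp Require Import all_classical all_reals all_analysis.

Set Implicit Arguments.
Unset Strict Implicit.
Unset Printing Implicit Defensive.

Import Order.TTheory GRing.Theory Num.Theory.
Import numFieldNormedType.Exports.

Local Open Scope classical_set_scope.
Local Open Scope card_scope.
Local Open Scope ring_scope.

(* There is no type of cardinals: a cardinal is represented by a set of that
   cardinality, and cardinals are compared with [#<=].  [F] is a family of
   sets, and [min_card F] represents min {|A| : A in F}. *)
Definition is_min_card (T : Type) (F : set (set T)) (A : set T) : Prop :=
  F A /\ forall B, F B -> A #<= B.

Definition min_card (T : Type) (F : set (set T)) : set T :=
  xget set0 (is_min_card F).

(* The default value of [xget] is used only if [F] is empty. *)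
Lemma min_cardP (T : Type) (F : set (set T)) :
  F !=set0 -> is_min_card F (min_card F).
Proof.
move=> [A0 FA0]; apply: xgetPex.
pose P (S : set (set T -> T)) :=
  (forall f A, S f -> F A -> A (f A)) /\
  (forall f g A, S f -> S g -> F A -> f A = g A -> f = g).
have [|S [[SF Sinj] Smax]] := @Zorn_bigcup _ P.
  move=> G GP Gtot; split=> [f A [X GX Xf]|f g A [X GX Xf] [Y GY Yg]].
    exact: (GP _ GX).1.
  have [XY|YX] := Gtot _ _ GX GY.
    by apply: (GP _ GY).2 => //; exact: XY.
  by apply: (GP _ GX).2 => //; exact: YX.
have [A FA SA] : exists2 A, F A & A `<=` (fun f => f A) @` S.
  apply: contrapT => noA.
  have ex A : F A -> exists2 a, A a & forall f, S f -> f A <> a.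
    move=> FA; apply: contrapT => noa; apply: noA; exists A => // a Aa.
    apply: contrapT => nSa; apply: noa; exists a => // f Sf fAa.
    by apply: nSa; exists f.
  have [a0 _ _] := ex A0 FA0.
  have /choice[g gP] : forall A, exists a, F A ->
      A a /\ forall f, S f -> f A <> a.
    move=> A; have [/ex[a Aa aS]|nFA] := pselect (F A); last by exists a0.
    by exists a.
  apply: (Smax (S `|` [set g])).
    rewrite properEneq; split; last by move=> f; left.
    apply/eqP => SE; have Sg : S g by rewrite SE; right.
    exact: (gP _ FA0).2 Sg erefl.
  split=> [f A [Sf|->] FA|f h A [Sf|->] [Sh|->] FA fhA] //.
  - exact: (SF f A).
  - exact: (gP A FA).1.
  - exact: Sinj fhA.
  - by case: ((gP _ FA).2 _ Sf).
  - by case: ((gP _ FA).2 _ Sh).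
exists A; split=> // B FB.
apply: card_le_trans (subset_card_le SA) _.
apply: card_le_trans (card_image_le _ _) _.
have SB : (fun f => f B) @` S `<=` B by move=> _ [f Sf <-]; exact: (SF f B).
apply: card_le_trans (subset_card_le SB).
have : (fun f => f B) @` S #= S.
  by apply: inj_card_eq => f h; rewrite !inE => Sf Sh; exact: Sinj.
by rewrite card_eq_le => /andP[].
Qed.

Definition density_zero (R : realType) : set (set nat) :=
  [set A | (fun n => #|` fset_set (A `&` `I_n)|%:R / n%:R : R) @ \oo --> 0].

Definition nonstar (I : set (set nat)) : set (set nat) :=
  min_card [set F | F `<=` [set A | infinite_set A] /\
    forall B, I B -> exists2 A, F A & finite_set (A `&` B)].

Definition covstar (I : set (set nat)) : set (set nat) :=
  min_card [set F | F `<=` I /\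
    forall B, infinite_set B -> exists2 A, F A & infinite_set (A `&` B)].

Definition cylinder (s : seq bool) : set cantor_space :=
  [set x : cantor_space | forall i, (i < size s)%N -> x i = nth false s i].

(* Lebesgue (outer) measure on 2^omega: the outer measure induced by giving
   the basic clopen set of s measure 2^-|s|. *)
Definition cantor_measure (R : realType) (A : set cantor_space) : \bar R :=
  ereal_inf [set (\sum_(0 <= k <oo) (2 ^- size (s k))%:E)%E
            | s in [set s : nat -> seq bool | A `<=` \bigcup_k cylinder (s k)]].

Definition sigma_ideal (T : Type) (I : set (set T)) : Prop :=
  [/\ I set0,
      forall A B, A `<=` B -> I B -> I A &
      forall A : nat -> set T, (forall n, I (A n)) -> I (\bigcup_n A n)].

Definition idealE (R : realType) : set (set cantor_space) :=
  smallest (@sigma_ideal cantor_space)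
    [set A | closed A /\ cantor_measure R A = 0%E].

Definition non (T : Type) (I : set (set T)) : set T :=
  min_card [set X | ~ I X].

Definition cov (T : Type) (I : set (set T)) : set (set T) :=
  min_card [set F | F `<=` I /\ \bigcup_(A in F) A = setT].

(* Main.v *)
(* Let Z be the density zero ideal.  For an infinite A and every j, fix a
   residue class mod 2^j that A meets infinitely often, and let g_A bound where
   A next meets these classes.  If f eventually dominates g_A, then a density
   zero set that runs through all residues mod 2^j on consecutive intervals of
   lengths prescribed by f meets A infinitely often (this is b <= non*(Z) and
   cov*(Z) <= d).

   Let x_A be the concatenation of the binary digits of elements of A whose
   distances outgrow g_A.  A set N in E is covered by closed null sets, and a
   closed null set has at most 2^m / 4^p prefixes of length m once m is large,
   say m >= h(p).  So the integers whose digits beyond the p lowest continue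
   some prefix to a prefix of a point of N form a density zero set.  If x_A is in N, then either g_A is eventually below
   h o h, and the set of the first paragraph catches A, or infinitely often
   the next element of A used in x_A is longer than h of the position reached,
   and this set catches A.  Hence a single density zero set depending on N
   catches all A with x_A in N, which gives the first two inequalities.

   For the third one, let the digits of w select one element of each block of
   length 2^k on the k-th interval of the partition given by f.  If f is not
   dominated by a function depending on the infinite set C, then infinitely
   many intervals contain many elements of C, and the w whose selection meets
   C finitely often form a set in E.  Taking f = g_A and w = x_A' for A, A' in
   a witness F of non*(Z) yields a witness of cov*(Z) of size |F x F| = |F|. *)
Require Import Defs.
From mathcomp Require Import all_boot all_order all_algebra finmap zify lra.
From mathcomp Require Import all_classical all_reals all_analysis.

Set Implicit Arguments.
Unset Strict Implicit.
Unset Printing Implicit Defensive.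

Import Order.TTheory GRing.Theory Num.Theory.
Import numFieldNormedType.Exports.

Local Open Scope classical_set_scope.
Local Open Scope card_scope.

(** * Squares of infinite sets *)

Lemma card_le_injP (T : Type) (U : pointedType) (A : set T) (B : set U) :
  A #<= B <->
  exists2 f : T -> U, (forall x, A x -> B (f x)) &
    forall x y, A x -> A y -> f x = f y -> x = y.
Proof.
split=> [/pcard_leP/injfunPex[f fAB finj]|[f fAB finj]].
  by exists f => // x y Ax Ay; apply: finj; rewrite inE.
apply/pcard_leP/injfunPex; exists f => // x y.
by rewrite !inE; exact: finj.
Qed.

(** The pair of the two sets has a member of least cardinality. *)
Lemma card_le_total (T : Type) (A B : set T) : A #<= B \/ B #<= A.
Proof.
have [|[->|->] H] := @min_cardP T [set A; B]; first by exists A; left.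
- by left; apply: H; right.
- by right; apply: H; left.
Qed.

(** [G] is the graph of a partial binary operation. Reading its carrier off the diagonal lets one
    relation hold both the carrier and the operation. *)
Definition diag (T : Type) (G : set (T * T * T)) : set T :=
  [set x | exists z, G (x, x, z)].

(** [G] is an injection of the square of its carrier into the carrier. In this form the union of a
    nonempty chain is an upper bound, as Zorn's lemma wants. *)
Definition pairing_on (T : Type) (A : set T) (G : set (T * T * T)) : Prop :=
  [/\ forall x y z z', G (x, y, z) -> G (x, y, z') -> z = z',
      forall x y x' y' z, G (x, y, z) -> G (x', y', z) -> x = x' /\ y = y',
      forall x y, diag G x -> diag G y -> exists z, G (x, y, z),
      forall x y z, G (x, y, z) -> [/\ diag G x, diag G y & diag G z] &
      diag G `<=` A].

Lemma diagS (T : Type) (G H : set (T * T * T)) :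
  G `<=` H -> diag G `<=` diag H.
Proof. by move=> GH x [z /GH Hz]; exists z. Qed.

Lemma pairing_on_bigcup (T : Type) (A : set T) (F : set (set (T * T * T))) :
  F `<=` pairing_on A -> total_on F subset -> pairing_on A (\bigcup_(G in F) G).
Proof.
move=> FP Ftot.
have up2 G G' : F G -> F G' -> exists2 K, F K & G `<=` K /\ G' `<=` K.
  move=> FG FG'; have [GG|GG] := Ftot _ _ FG FG'.
    by exists G' => //; split.
  by exists G => //; split.
have dS G : F G -> diag G `<=` diag (\bigcup_(G in F) G).
  by move=> FG; apply: diagS => u Gu; exists G.
split.
- move=> x y z z' [G FG Gz] [G' FG' Gz'].
  have [K FK [GK G'K]] := up2 _ _ FG FG'.
  by have [+ _ _ _ _] := FP _ FK; apply; [exact: GK Gz|exact: G'K Gz'].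
- move=> x y x' y' z [G FG Gz] [G' FG' Gz'].
  have [K FK [GK G'K]] := up2 _ _ FG FG'.
  by have [_ + _ _ _] := FP _ FK; apply; [exact: GK Gz|exact: G'K Gz'].
- move=> x y [z [G FG Gz]] [z' [G' FG' Gz']].
  have [K FK [GK G'K]] := up2 _ _ FG FG'.
  have [_ _ + _ _] := FP _ FK => /(_ x y)[].
  + by exists z; exact: GK.
  + by exists z'; exact: G'K.
  + by move=> w Kw; exists w; exists K.
- move=> x y z [G FG Gz]; have [_ _ _ + _] := FP _ FG => /(_ _ _ _ Gz)[].
  by split; exact: (dS G).
- move=> x [z [G FG Gz]]; have [_ _ _ _] := FP _ FG; apply.
  by exists z.
Qed.

(** A copy of a pairing function of the naturals starts the Zorn argument; the two distinct points
    later serve as tags. *)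
Lemma pairing_on_nat (T : pointedType) (A : set T) : infinite_set A ->
  exists2 G, pairing_on A G &
    exists c d, [/\ diag G c, diag G d & c <> d].
Proof.
move=> /infiniteP/card_le_injP[i iA iinj].
have [p pinj] : exists p : nat * nat -> nat, injective p.
  by exists choice.pickle; exact: pcan_inj choice.pickleK.
have {}iinj m n : i m = i n -> m = n by exact: iinj.
pose G : set (T * T * T) := [set u | exists m n, u = (i m, i n, i (p (m, n)))].
have dG m : diag G (i m) by exists (i (p (m, m))), m, m.
exists G; last by exists (i 0), (i 1); split=> // /iinj.
split.
- move=> x y z z' [m [n [-> -> ->]]] [m' [n' [/iinj <- /iinj <- ->]]] //.
- by move=> x y x' y' z [m [n [-> -> ->]]] [m' [n' [-> -> /iinj/pinj[-> ->]]]].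
- move=> x y [_ [m [_ [-> _ _]]]] [_ [n [_ [-> _ _]]]].
  by exists (i (p (m, n))), m, n.
- by move=> x y z [m [n [-> -> ->]]].
- by move=> x [_ [m [_ [-> _ _]]]]; exact: iA.
Qed.

(* Zorn's lemma gives a maximal injection [H] of [Y * Y] into [Y], where
   [Y `<=` A] has two elements.  Either [A `\` Y] embeds into [Y], and then so
   does [A]; or [Y] embeds into [A `\` Y], and then [H] is not maximal. *)
Lemma card_square (T : pointedType) (A : set T) :
  infinite_set A -> A `*` A #<= A.
Proof.
move=> /pairing_on_nat[G0 PG0 [c [d [G0c G0d cd]]]].
(* Joining [G0] to each candidate makes the empty union admissible and puts [c] and [d] into the
   carrier of the maximal element. *)
have [|G [PG Gmax]] := @Zorn_bigcup _ (fun G => pairing_on A (G0 `|` G)).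
  move=> F FP Ftot.
  have [->|/set0P[G1 FG1]] := eqVneq F set0.
    by rewrite bigcup_set0 setU0.
  have -> : G0 `|` \bigcup_(X in F) X =
            \bigcup_(X in (fun X => G0 `|` X) @` F) X.
    apply/seteqP; split=> [u [G0u|[X FX Xu]]|u [_ [X FX <-]] [G0u|Xu]].
    - by exists (G0 `|` G1); [exists G1|left].
    - by exists (G0 `|` X); [exists X|right].
    - by left.
    - by right; exists X.
  apply: pairing_on_bigcup => [_ [X FX <-]|_ _ [X FX <-] [X' FX' <-]].
    exact: FP.
  by have [?|?] := Ftot _ _ FX FX'; [left|right]; exact: setUS.
set H := G0 `|` G in PG; pose Y := diag H.
have Yc : Y c by apply: diagS G0c; exact: subsetUl.
have Yd : Y d by apply: diagS G0d; exact: subsetUl.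
have Hmax H' : H `<=` H' -> pairing_on A H' -> H' `<=` H.
  move=> HH' PH'; apply: contrapT => H'H; apply: (Gmax H').
    split; first by move=> u Gu; apply: HH'; right.
    by move=> H'G; apply: H'H => u /H'G; right.
  by rewrite (_ : _ `|` _ = H') //; apply/setUidPr => u G0u; apply: HH'; left.
have [Hfun Hinj Htot Hdiag YA] := PG.
have /boolp.choice[f fP] : forall u, exists z, Y u.1 -> Y u.2 -> H (u, z).
  move=> [x y].
  have [Yx|nYx] := pselect (Y x); last by exists c.
  have [Yy|nYy] := pselect (Y y); last by exists c.
  by have [z Hz] := Htot _ _ Yx Yy; exists z.
have fY x y : Y x -> Y y -> Y (f (x, y)).
  by move=> Yx Yy; have [] := Hdiag _ _ _ (fP (x, y) Yx Yy).
have finj x y x' y' : Y x -> Y y -> Y x' -> Y y' -> f (x, y) = f (x', y') ->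
    x = x' /\ y = y'.
  move=> Yx Yy Yx' Yy' ff; apply: (Hinj _ _ _ _ (f (x, y))).
    exact: (fP (x, y)).
  by rewrite ff; exact: (fP (x', y')).
have [|] := card_le_total (A `\` Y) Y.
  move=> /card_le_injP[e eY einj].
  (* The tags [c] and [d] keep the images of [Y] and of its complement in [A] apart inside [Y]. *)
  pose g u := if u \in Y then f (u, c) else f (e u, d).
  have gY u : A u -> Y (g u).
    rewrite /g; case: ifPn => [/set_mem Yu _|/negP nYu Au]; first exact: fY.
    by apply: fY => //; apply: eY; split=> // Yu; apply: nYu; rewrite inE.
  have ginj u v : A u -> A v -> g u = g v -> u = v.
    rewrite /g => Au Av; case: ifPn => [|/negP] Yu; case: ifPn => [|/negP] Yv.
    - by move: Yu Yv => /set_mem Yu /set_mem Yv /finj[].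
    - have Ev : Y (e v).
        by apply: eY; split=> // ?; apply: Yv; rewrite inE.
      by move: Yu => /set_mem Yu /finj[] // _ /cd.
    - have Eu : Y (e u).
        by apply: eY; split=> // ?; apply: Yu; rewrite inE.
      by move: Yv => /set_mem Yv /finj[] // _ /esym/cd.
    - have Du : (A `\` Y) u by split=> // ?; apply: Yu; rewrite inE.
      have Dv : (A `\` Y) v by split=> // ?; apply: Yv; rewrite inE.
      by move=> /finj[]; [exact: eY|by []|exact: eY|by []|move=> /einj->].
  apply/card_le_injP; exists (fun u => f (g u.1, g u.2)).
    by move=> [u v] [Au Av] /=; apply/YA/fY; exact: gY.
  move=> [u v] [u' v'] [/= Au Av] [/= Au' Av'].
  by move=> /finj[]; try exact: gY; move=> /ginj-> // /ginj->.
move=> /card_le_injP[p pY pinj]; exfalso.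
(* [Y] is enlarged by a disjoint copy of itself: [q] folds the copy back, [t] records the half, and
   [r] sends new pairs into the copy, where [H] takes no values. *)
pose Y' := Y `|` p @` Y.
have /boolp.choice[q qP] : forall u, exists z, Y' u ->
    Y z /\ ((Y u /\ z = u) \/ (~ Y u /\ p z = u)).
  move=> u.
  have [Yu|nYu] := pselect (Y u); first by exists u; split=> //; left.
  have [[z Yz <-]|nYp] := pselect ((p @` Y) u).
    by exists z; split=> //; right; split=> //; have [] := pY z Yz.
  by exists c => -[].
have qY u : Y' u -> Y (q u) by move=> /qP[].
pose t u := if u \in Y then c else d.
have tY u : Y (t u) by rewrite /t; case: ifP.
have qtinj u v : Y' u -> Y' v -> q u = q v -> t u = t v -> u = v.
  rewrite /t => Y'u Y'v quv.
  case: ifPn => [|/negP] Yu; case: ifPn => [|/negP] Yv //; [|by move=> /esym|].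
    move: Yu Yv => /set_mem Yu /set_mem Yv _.
    have [_ [[_ <-]|[//]]] := qP _ Y'u.
    by have [_ [[_ <-]|[//]]] := qP _ Y'v.
  rewrite !inE in Yu Yv => _.
  have [_ [[//]|[_ <-]]] := qP _ Y'u.
  by have [_ [[//]|[_ <-]]] := qP _ Y'v; rewrite quv.
pose r u v := p (f (f (q u, q v), f (t u, t v))).
have rY u v : Y' u -> Y' v -> (p @` Y) (r u v).
  by move=> Y'u Y'v; exists (f (f (q u, q v), f (t u, t v))) => //; apply: (fY _ _);
     apply: fY => //; exact: qY.
have rinj u v u' v' : Y' u -> Y' v -> Y' u' -> Y' v' -> r u v = r u' v' ->
    u = u' /\ v = v'.
  move=> Yu Yv Yu' Yv' /pinj E.
  have Q x y : Y' x -> Y' y -> Y (f (q x, q y)) by move=> *; apply: fY; exact: qY.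
  have S x y : Y (f (t x, t y)) by apply: fY; exact: tY.
  have [E1 E2] := finj _ _ _ _ (Q _ _ Yu Yv) (S _ _) (Q _ _ Yu' Yv') (S _ _)
    (E (fY _ _ (Q _ _ Yu Yv) (S _ _)) (fY _ _ (Q _ _ Yu' Yv') (S _ _))).
  have [q1 q2] := finj _ _ _ _ (qY _ Yu) (qY _ Yv) (qY _ Yu') (qY _ Yv') E1.
  have [t1 t2] := finj _ _ _ _ (tY _) (tY _) (tY _) (tY _) E2.
  by split; exact: qtinj.
have pN u : Y u -> ~ Y (p u) by move=> /pY[].
pose H' : set (T * T * T) := [set w | H w \/
  [/\ Y' w.1.1, Y' w.1.2, ~ (Y w.1.1 /\ Y w.1.2) & w.2 = r w.1.1 w.1.2]].
have HY x y z : H (x, y, z) -> [/\ Y x, Y y & Y z] by exact: Hdiag.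
have dH' : diag H' = Y'.
  apply/seteqP; split=> [x [z [/HY[Yx _ _]|[]//]]|x]; first by left.
  have [[z Hz] _|nYx Y'x] := pselect (Y x); first by exists z; left.
  by exists (r x x); right; split=> //= -[].
have pYY x : (p @` Y) x -> ~ Y x by move=> [y /pN + <-].
have PH' : pairing_on A H'.
  rewrite /pairing_on dH'; split.
  - move=> x y z z' [Hz|[/= Yx Yy nY ->]] [Hz'|[/= Yx' Yy' nY' ->]] //.
    + exact: Hfun Hz Hz'.
    + by have [? ? _] := HY _ _ _ Hz; case: nY'.
    + by have [? ? _] := HY _ _ _ Hz'; case: nY.
  - move=> x y x' y' z [Hz|[/= Yx Yy nY zE]] [Hz'|[/= Yx' Yy' nY' zE']].
    + exact: Hinj Hz Hz'.
    + by have [_ _] := HY _ _ _ Hz; rewrite zE' => /pYY; case; exact: rY.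
    + by have [_ _] := HY _ _ _ Hz'; rewrite zE => /pYY; case; exact: rY.
    + by apply: rinj => //; rewrite -zE.
  - move=> x y Y'x Y'y; have [[Yx Yy]|nY] := pselect (Y x /\ Y y).
      by have [z Hz] := Htot _ _ Yx Yy; exists z; left.
    by exists (r x y); right.
  - move=> x y z [/HY[Yx Yy Yz]|[/= Yx Yy _ ->]]; first by split; left.
    by split=> //; right; exact: rY.
  - move=> x [/YA//|[y /pY[Ap _] <-]//].
have /(_ (p c, p c, r (p c) (p c))) := Hmax H' (fun u Hu => or_introl Hu) PH'.
have Y'pc : Y' (p c) by right; exists c.
have : ~ Y (p c) by exact: pN.
move=> nYpc /(_ _)/HY[]//.
by right; split=> //= -[].
Qed.

(** * Asymptotic density *)

Lemma finite_natP (A : set nat) :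
  finite_set A <-> exists k, forall n, A n -> n < k.
Proof.
split=> [/finite_seqP[s ->]|[k kP]]; last first.
  exact: sub_finite_set (finite_II k).
exists (\max_(i <- s) i).+1 => n /= sn.
by rewrite ltnS (@leq_bigmax_seq nat s xpredT id).
Qed.

Lemma infinite_natP (A : set nat) :
  infinite_set A <-> forall k, exists2 n, k <= n & A n.
Proof.
split=> [Ainf k|Ainf /finite_natP[k kP]].
  apply: contrapT => nk; apply: Ainf; apply/finite_natP; exists k => n An.
  by rewrite ltnNge; apply/negP => kn; apply: nk; exists n.
by have [n kn /kP] := Ainf k; rewrite ltnNge kn.
Qed.

Definition cnt (B : set nat) (n : nat) : nat :=
  count (fun i => `[< B i >]) (iota 0 n).

Lemma card_fset_setI (B : set nat) (n : nat) :
  #|` fset_set (B `&` `I_n)| = cnt B n.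
Proof.
rewrite /cnt -size_filter; apply: perm_size; apply: uniq_perm.
- exact: fset_uniq.
- by rewrite filter_uniq ?iota_uniq.
have fin : finite_set (B `&` `I_n) by apply: finite_setIr; exact: finite_II.
move=> i; rewrite mem_filter mem_iota /= add0n.
apply/idP/andP => [|[/asboolP Bi ltin]].
  by rewrite (in_fset_set fin) inE => -[Bi ?]; split=> //; exact/asboolP.
by rewrite (in_fset_set fin) inE.
Qed.

(** With epsilon traded for a reciprocal [1/c], all later density estimates are inequalities between
    naturals. *)
Lemma density_zeroP (R : realType) (B : set nat) :
  density_zero R B <->
  forall c, exists M, forall n, M <= n -> c * cnt B n <= n.
Proof.
rewrite /density_zero /=; under eq_fun do rewrite card_fset_setI.
split=> [/cvgr0Pnorm_le cv c|cv].
  have [->|c0] := posnP c; first by exists 0 => n _; rewrite mul0n.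
  have /cv[M _ MP] : (0 < c%:R^-1 :> R)%R by rewrite invr_gt0 ltr0n.
  exists M.+1 => n Mn; have n0 : 0 < n by lia.
  have := MP n (ltnW Mn).
  rewrite ger0_norm ?divr_ge0 ?ler0n// ler_pdivrMr ?ltr0n//.
  by rewrite ler_pdivlMl ?ltr0n// -natrM ler_nat.
apply/cvgr0Pnorm_le => e e0.
have [c _ ce] : \forall c \near \oo, (e^-1 <= c%:R :> R)%R by exact: nbhs_infty_ger.
have [M MP] := cv c.+1.
exists M.+1 => // n /= Mn; have n0 : 0 < n by lia.
rewrite ger0_norm ?divr_ge0 ?ler0n// ler_pdivrMr ?ltr0n//.
have {}MP := MP n (ltnW Mn).
rewrite -(@ler_pM2l _ (c.+1)%:R%R) ?ltr0n// mulrA -natrM.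
apply: (@le_trans _ _ n%:R%R); first by rewrite ler_nat.
rewrite ler_peMl ?ler0n//.
rewrite -ler_pdivrMr// div1r; apply: le_trans (ce c (leqnn c)) _.
by rewrite ler_nat.
Qed.

Lemma cnt_leq (B : set nat) (m n : nat) : m <= n -> cnt B m <= cnt B n.
Proof. by move=> mn; rewrite /cnt -(subnKC mn) iotaD count_cat leq_addr. Qed.

Lemma density_zeroU (R : realType) (A B : set nat) :
  density_zero R A -> density_zero R B -> density_zero R (A `|` B).
Proof.
move=> /density_zeroP ZA /density_zeroP ZB; apply/density_zeroP => c.
have [[M MP] [M' MP']] := (ZA c.*2, ZB c.*2).
exists (M + M') => n Mn.
have := MP n (leq_trans (leq_addr _ _) Mn).
have := MP' n (leq_trans (leq_addl _ _) Mn).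
suff : cnt (A `|` B) n <= cnt A n + cnt B n by nia.
rewrite /cnt -count_predUI; apply: leq_trans (leq_addr _ _).
by apply: sub_count => i /asboolP[?|?] /=; apply/orP; [left|right]; apply/asboolP.
Qed.

(** Beyond [M] each block of length [2 ^ j] holds at most one element, so the upper density is at
    most [1 / 2 ^ j] for every [j]. *)
Lemma density_zero_blocks (R : realType) (B : set nat) :
  (forall j, exists M, forall a b, B a -> B b -> M <= a -> M <= b ->
    a %/ 2 ^ j = b %/ 2 ^ j -> a = b) ->
  density_zero R B.
Proof.
move=> blocks; apply/density_zeroP => c.
have [M MP] := blocks c.*2.
have cj : c.*2 < 2 ^ c.*2 by exact: ltn_expl.
set q := 2 ^ _ in cj MP.
(* Half of [n] pays for [c * (M + 1)], the other half for [c * (n %/ q)], as [2 * c < q]. *)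
exists (2 * (c * (M + 1))) => n nM.
suff cnt_le : cnt B n <= M + (n %/ q + 1).
  have := leq_mul (leqnn c) cnt_le.
  have := leq_mul (ltnW cj) (leqnn (n %/ q)).
  by have := leq_trunc_div n q; lia.
have [nM'|Mn] := leqP n M.
  by rewrite (leq_trans (count_size _ _))// size_iota (leq_trans nM')// leq_addr.
rewrite /cnt -(subnKC (ltnW Mn)) iotaD count_cat add0n.
apply: leq_add; first by rewrite -{2}(size_iota 0 M) count_size.
rewrite subnKC; last exact: ltnW.
rewrite -size_filter -(size_map (fun i => i %/ q)) addn1.
rewrite -(size_iota 0 (n %/ q).+1); apply: uniq_leq_size.
  rewrite map_inj_in_uniq ?filter_uniq ?iota_uniq//.
  move=> a b; rewrite !mem_filter !mem_iota => /andP[/asboolP Ba /andP[Ma _]].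
  by move=> /andP[/asboolP Bb /andP[Mb _]]; exact: MP.
move=> x /mapP[a + ->]; rewrite mem_filter mem_iota => /andP[_ /andP[_ an]].
by rewrite mem_iota add0n /= ltnS leq_div2r//; lia.
Qed.

Lemma density_zero_dyadic (R : realType) (B : set nat) :
  (forall p, exists M, forall m, M <= m ->
    count (fun i => `[< B i >]) (iota (2 ^ m) (2 ^ m)) * 2 ^ p <= 2 ^ m) ->
  density_zero R B.
Proof.
move=> dyadic; apply/density_zeroP => c.
(* The power of two just above [n] is at most [2 * n], and [2 ^ M * q <= n]; hence
   [cnt B n * q <= 3 * n], while [q] exceeds [4 * c]. *)
have [M MP] := dyadic (4 * c).
have cp : 4 * c < 2 ^ (4 * c) by exact: ltn_expl.
set q := 2 ^ _ in cp MP.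
have cnt_pow m : M <= m -> cnt B (2 ^ m) * q <= 2 ^ M * q + 2 ^ m.
  elim: m => [|m IH].
    rewrite leqn0 => /eqP->; apply: leq_trans (leq_addr _ _).
    by rewrite leq_mul2r -[leqRHS](size_iota 0) count_size orbT.
  rewrite leq_eqVlt => /predU1P[->|/ltnSE Mm].
    apply: leq_trans (leq_addr _ _).
    by rewrite leq_mul2r -[leqRHS](size_iota 0) count_size orbT.
  rewrite expnS mul2n -{1}addnn /cnt iotaD count_cat add0n.
  by have := MP m Mm; have := IH Mm; rewrite /cnt; lia.
exists (2 ^ M * q + 2 ^ M) => n nM.
have n0 : 0 < n by have := expn_gt0 2 M; lia.
have /andP[lo hi] := trunc_log_bounds (leqnn 2) n0.
have Mm : M <= (trunc_log 2 n).+1.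
  by apply/leqW/trunc_log_max => //; lia.
have := cnt_pow _ Mm; have := cnt_leq B (ltnW hi).
rewrite expnS in hi *; nia.
Qed.

(** Ensures that the family of infinite sets is a candidate in the minimum defining [nonstar]. *)
Lemma density_zero_setC_infinite (R : realType) (B : set nat) :
  density_zero R B -> infinite_set (~` B).
Proof.
move=> /density_zeroP/(_ 2)[M MP] /finite_natP[k kP].
pose n := M + k + k + 1.
have : n - k <= cnt B n.
  rewrite /cnt -[X in iota 0 X](@subnKC k n) /n; last by lia.
  rewrite iotaD count_cat; apply: leq_trans (leq_addl _ _).
  rewrite -[leqLHS](size_iota (0 + k)); apply/eq_leq/esym/eqP.
  rewrite -all_count; apply/allP => i; rewrite mem_iota => /andP[ki _].
  by apply/asboolP; apply: contrapT => nBi; have := kP i nBi; lia.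
by have := MP n; rewrite /n; lia.
Qed.

(** * Density zero sets that catch infinite sets *)

Section Intervals.
Variable s : nat -> nat.
Hypothesis s_lt : forall k, s k < s k.+1.

Lemma interval_leq : {homo s : m n / m <= n}.
Proof. by apply: homo_leq => [//|y x z|k]; [exact: leq_trans|exact: ltnW]. Qed.

Lemma interval_id_leq (k : nat) : k <= s k.
Proof. by elim: k => // k IH; exact: leq_ltn_trans (s_lt k). Qed.

Lemma interval_index_leq (n n' k k' : nat) :
  n <= n' -> s k <= n -> n' < s k'.+1 -> k <= k'.
Proof.
move=> nn' kn nk'; rewrite leqNgt; apply/negP => /interval_leq; lia.
Qed.

Lemma interval_index_inj (n k k' : nat) :
  s k <= n < s k.+1 -> s k' <= n < s k'.+1 -> k = k'.
Proof.
move=> /andP[kn nk] /andP[k'n nk']; apply/eqP; rewrite eqn_leq.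
rewrite (interval_index_leq (leqnn n) kn nk').
exact: (interval_index_leq (leqnn n) k'n nk).
Qed.

Hypothesis s0 : s 0 = 0.

Lemma ex_interval (n : nat) : exists k, s k <= n < s k.+1.
Proof.
have ex : exists k, n < s k.+1 by exists n; exact: interval_id_leq.
case: (ex_minnP ex) => -[|k] nk kmin; first by exists 0; rewrite s0.
exists k.+1; rewrite nk andbT leqNgt; apply/negP => /kmin.
by rewrite ltnn.
Qed.

End Intervals.

(** The added term makes the interval from [mark f k] reach past [f (mark f k)]; the factor [2 ^ k]
    aligns the marks with dyadic blocks. *)
Fixpoint mark (f : nat -> nat) (k : nat) : nat :=
  if k is k'.+1 then 2 ^ k * (mark f k' + f (mark f k')).+1 else 0.

Section Mark.
Variable f : nat -> nat.

Lemma mark_next (k : nat) : mark f k + f (mark f k) < mark f k.+1.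
Proof. by rewrite /= leq_pmull ?expn_gt0. Qed.

Lemma mark_lt (k : nat) : mark f k < mark f k.+1.
Proof. exact: leq_ltn_trans (leq_addr _ _) (mark_next k). Qed.

Lemma dvdn_mark (j k : nat) : j <= k -> 2 ^ j %| mark f k.
Proof.
by case: k => [|k] jk; [exact: dvdn0|apply: dvdn_mulr; exact: dvdn_exp2l].
Qed.

Lemma leq_mark (k : nat) : k <= mark f k.
Proof. exact/interval_id_leq/mark_lt. Qed.

End Mark.

Definition level_set (f : nat -> nat) (P : nat -> nat -> Prop) : set nat :=
  [set n | exists2 k, mark f k <= n < mark f k.+1 & P k n].

(** Far out, each block of length [2 ^ j] lies inside one level, since marks are multiples of
    [2 ^ j], and it lies inside one block of length [2 ^ l k], which [P] allows one element. *)
Lemma density_zero_level_set (R : realType) (f : nat -> nat)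
    (P : nat -> nat -> Prop) (l : nat -> nat) :
  (forall k, l k <= k) -> (forall j, exists K, forall k, K <= k -> j <= l k) ->
  (forall k a b, P k a -> P k b -> a %/ 2 ^ l k = b %/ 2 ^ l k -> a = b) ->
  density_zero R (level_set f P).
Proof.
move=> lk linf Pinj; apply: density_zero_blocks => j.
have [K KP] := linf j; exists (mark f K).
have fS := mark_lt f.
have idx n k : mark f K <= n -> mark f k <= n < mark f k.+1 -> K <= k.
  by move=> Kn /andP[_ nk]; exact: interval_index_leq (leqnn n) _ nk.
have lt_level a k b k' : mark f K <= b -> mark f k <= a < mark f k.+1 ->
    mark f k' <= b < mark f k'.+1 -> k < k' -> a %/ 2 ^ j < b %/ 2 ^ j.
  move=> Kb /andP[_ ak] bk' kk'.
  have jk' : j <= k' by exact: leq_trans (KP _ (idx _ _ Kb bk')) (lk _).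
  apply: (@leq_trans (mark f k' %/ 2 ^ j)); last first.
    by apply: leq_div2r; case/andP: bk'.
  rewrite ltn_divLR ?expn_gt0// divnK ?dvdn_mark//.
  exact: leq_trans ak (interval_leq fS kk').
move=> a b [k ak Pa] [k' bk' Pb] Ka Kb ab.
have [kk'|k'k|kk'] := ltngtP k k'.
- by have := lt_level _ _ _ _ Kb ak bk' kk'; rewrite ab ltnn.
- by have := lt_level _ _ _ _ Ka bk' ak k'k; rewrite ab ltnn.
rewrite -kk' in Pb; apply: Pinj Pa Pb _.
by rewrite -(subnKC (KP k (idx a k Ka ak))) expnD !divnMA ab.
Qed.

(** As [k] runs from [2 ^ j] to [2 ^ j.+1 - 1], the modulus stays [2 ^ j] and [k] takes every
    residue once. *)
Definition residue_set (f : nat -> nat) : set nat :=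
  level_set f (fun k n => n = k %[mod 2 ^ trunc_log 2 k]).

Lemma density_zero_residue_set (R : realType) (f : nat -> nat) :
  density_zero R (residue_set f).
Proof.
apply: (@density_zero_level_set _ _ _ (trunc_log 2)).
- move=> [|k]; first by rewrite trunc_log0.
  by apply/ltnW/(leq_trans (ltn_expl _ (leqnn 2)))/trunc_logP.
- by move=> j; exists (2 ^ j) => k jk; exact: trunc_log_max.
- move=> k a b ak bk ab.
  by rewrite (divn_eq a (2 ^ trunc_log 2 k)) ab ak -bk -divn_eq.
Qed.

Lemma infinite_residue (A : set nat) (d : nat) : infinite_set A -> 0 < d ->
  exists2 r, r < d & infinite_set (A `&` [set n | n = r %[mod d]]).
Proof.
move=> Ainf d0; apply: contrapT => noinf; apply: Ainf.
have -> : A = \bigcup_(r in `I_d) (A `&` [set n | n = r %[mod d]]).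
  apply/seteqP; split=> [n An|n [r _ []]//].
  by exists (n %% d); [exact: ltn_pmod|split=> //=; rewrite modn_mod].
apply: bigcup_finite (finite_II d) _ => r rd.
by apply: contrapT => rinf; apply: noinf; exists r.
Qed.

Definition eventually_le (g f : nat -> nat) : Prop :=
  exists n0, forall n, n0 <= n -> g n <= f n.

Lemma residue_set_capture (A : set nat) : infinite_set A ->
  exists2 g, {homo g : m n / m <= n} &
    forall f, eventually_le g f -> infinite_set (A `&` residue_set f).
Proof.
move=> Ainf.
have /boolp.choice[r rP] j : exists r, r < 2 ^ j /\
    infinite_set (A `&` [set n | n = r %[mod 2 ^ j]]).
  have [|r] := infinite_residue (d := 2 ^ j) Ainf; first by rewrite expn_gt0.
  by exists r.
have /boolp.choice[G GP] u : exists a,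
    [/\ A a, u.2 <= a & a = r u.1 %[mod 2 ^ u.1]].
  have [_ /infinite_natP/(_ u.2)[a ua [Aa ra]]] := rP u.1.
  by exists a.
(* The maximum over all indices up to [n] makes the bound monotone. *)
pose F n (u : 'I_n.+1 * 'I_n.+1) := G (val u.1, val u.2).
have FP n j i : j <= n -> i <= n -> G (j, i) <= \max_u F n u.
  move=> jn ino; rewrite -ltnS in jn; rewrite -ltnS in ino.
  exact: (@leq_bigmax _ (F n) (Ordinal jn, Ordinal ino)).
exists (fun n => (\max_u F n u).+1).
  move=> m n mn; rewrite ltnS; apply/bigmax_leqP => -[j i] _ /=.
  by apply: FP; apply: leq_trans mn; rewrite -ltnS ltn_ord.
move=> f [n0 fP]; apply/infinite_natP => N.
(* At level [2 ^ j + r j] the modulus is [2 ^ j] and the prescribed residue is [r j], the class that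
   [A] meets infinitely often. *)
pose j := n0 + N; pose k := 2 ^ j + r j.
have [rj _] := rP j.
have jk : j <= k by rewrite /k; have := ltn_expl j (leqnn 2); lia.
have jn : j <= mark f k by exact: leq_trans (leq_mark f k).
have [Aa na ra] := GP (j, mark f k).
set a := G _ in Aa na ra.
exists a; first by rewrite /= in na; lia.
split=> //; exists k.
  rewrite na /=; apply: leq_trans (mark_next f k).
  rewrite ltnS; apply: leq_trans (leq_addl _ _); apply: ltnW.
  apply: leq_trans (fP _ _); last by lia.
  by rewrite ltnS; exact: FP.
rewrite (@trunc_log_eq 2 j)//; first by rewrite /k modnDl.
by rewrite /k leq_addr expnS; lia.
Qed.

Lemma ex_residue_bound : exists g : set nat -> nat -> nat,
  forall A, infinite_set A -> {homo g A : m n / m <= n} /\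
    forall f, eventually_le (g A) f -> infinite_set (A `&` residue_set f).
Proof.
have /boolp.choice[g gP] A : exists g, infinite_set A ->
    {homo g : m n / m <= n} /\
    forall f, eventually_le g f -> infinite_set (A `&` residue_set f).
  have [Ainf|] := pselect (infinite_set A); last by exists id.
  by have [g] := residue_set_capture Ainf; exists g.
by exists g.
Qed.

(** * Binary digits, guesses and codes *)

Definition bit (n i : nat) : bool := odd (n %/ 2 ^ i).

Lemma modn_bit (c k : nat) : c %% 2 ^ k.+1 = c %% 2 ^ k + bit c k * 2 ^ k.
Proof.
have lt_rem : c %% 2 ^ k + bit c k * 2 ^ k < 2 ^ k.+1.
  have : c %% 2 ^ k < 2 ^ k by rewrite ltn_pmod// expn_gt0.
  by rewrite expnS; case: (bit c k); rewrite ?mul1n ?mul0n; lia.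
rewrite {1}(divn_eq c (2 ^ k)) -(odd_double_half (c %/ 2 ^ k)) -/(bit c k).
rewrite mulnDl -muln2 -mulnA -expnS.
by rewrite addnAC addnC modnMDl addnC modn_small.
Qed.

Lemma bit_eq_mod (j k a b : nat) : j <= k -> a = b %[mod 2 ^ j] ->
  (forall i, j <= i < k -> bit a i = bit b i) -> a = b %[mod 2 ^ k].
Proof.
move=> /subnKC <-; elim: (k - j) => [|d IH] abj ab; first by rewrite addn0.
rewrite addnS !modn_bit IH// => [|i ij]; last by apply: ab; lia.
by rewrite ab//; lia.
Qed.

(** The [k] digits of [w] at the start of each block of length [2 ^ k] name one element of the
    block. As [k < 2 ^ k], different blocks consult different digits. *)
Definition guess_set (f : nat -> nat) (w : nat -> bool) : set nat :=
  level_set f (fun k n =>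
    forall i, i < k -> w (2 ^ k * (n %/ 2 ^ k) + i) = bit n i).

Lemma density_zero_guess_set (R : realType) (f : nat -> nat) (w : nat -> bool) :
  density_zero R (guess_set f w).
Proof.
apply: (@density_zero_level_set _ _ _ id) => //; first by move=> j; exists j.
move=> k a b wa wb ab.
rewrite (divn_eq a (2 ^ k)) (divn_eq b (2 ^ k)) ab; congr (_ + _).
apply: (@bit_eq_mod 0) => [//||i ik]; first by rewrite expn0 !modn1.
by rewrite -wa// ab wb.
Qed.

(* The binary digits of sparse elements of [A], laid end to end; the distance
   between consecutive elements outgrows [f]. *)
Definition is_code (A : set nat) (f : nat -> nat) (x : nat -> bool)
    (p : nat -> nat) : Prop :=
  [/\ p 0 = 0, forall l, p l < p l.+1 &
    forall l, exists a, [/\ A a, trunc_log 2 a = p l.+1, f (p l) <= p l.+1 &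
      forall i, p l <= i < p l.+1 -> x i = bit a i]].

Lemma ex_code (A : set nat) (f : nat -> nat) :
  infinite_set A -> exists x p, is_code A f x p.
Proof.
move=> Ainf.
have /boolp.choice[nxt nxtP] q : exists a, A a /\ 2 ^ q <= a.
  by have /infinite_natP/(_ (2 ^ q))[a] := Ainf; exists a.
(* The exponent forces the next position both beyond [q] and up to [f q]. *)
pose a q := nxt (maxn (f q) q.+1).
pose p l := iter l (fun q => trunc_log 2 (a q)) 0.
have p_next l : maxn (f (p l)) (p l).+1 <= p l.+1.
  rewrite /p iterS; apply: trunc_log_max => //.
  by have [] := nxtP (maxn (f (p l)) (p l).+1).
have p_lt l : p l < p l.+1 by exact: leq_trans (leq_maxr _ _) (p_next l).
have /boolp.choice[x xP] i : exists b, forall l, p l <= i < p l.+1 ->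
    b = bit (a (p l)) i.
  have [k ki] := ex_interval p_lt (erefl (p 0)) i.
  exists (bit (a (p k)) i) => l li.
  by rewrite (interval_index_inj p_lt ki li).
exists x, p; split=> // l; exists (a (p l)); split=> [|//||i li].
- by have [] := nxtP (maxn (f (p l)) (p l).+1).
- exact: leq_trans (leq_maxl _ _) (p_next l).
- exact: xP.
Qed.

(** The [p] lowest digits are free because a code copies an element only from the current position
    on; the leading digit is always 1 and is not copied. *)
Definition tree_set (h : nat -> nat) (C : nat -> set cantor_space) : set nat :=
  [set n | exists2 p, h p <= trunc_log 2 n < h p.+1 &
    exists2 y, C p y & forall i, p <= i < trunc_log 2 n -> y i = bit n i].

Lemma tree_set_capture (h : nat -> nat) (C : nat -> set cantor_space)
    (A : set nat) (f : nat -> nat) (x : cantor_space) (p : nat -> nat) (q : nat) :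
  h 0 = 0 -> (forall k, h k < h k.+1) -> {homo f : m n / m <= n} ->
  is_code A f x p -> (forall k, q <= k -> C k x) ->
  ~ eventually_le f (h \o h) -> infinite_set (A `&` tree_set h C).
Proof.
move=> h0 h_lt f_le [p0 p_lt pP] Cx nfh; apply/infinite_natP => N.
have hS := interval_leq h_lt; have pS := interval_leq p_lt.
(* Otherwise, for large [n] in the interval from [p l] to [p l.+1], [f n <= f (p l.+1) <= p l.+2 < h
   (p l.+1) <= h (h (p l)) <= h (h n)]. *)
have [l ql hl] : exists2 l, N + q <= l & h (p l) <= p l.+1.
  apply: contrapT => nex; apply: nfh; exists (p (N + q)) => n pn /=.
  have ph l : N + q <= l -> p l.+1 < h (p l).
    by move=> ql; rewrite ltnNge; apply/negP => ?; apply: nex; exists l.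
  have [l /andP[ln nl]] := ex_interval p_lt p0 n.
  have ql : N + q <= l by exact: (interval_index_leq p_lt (leqnn n) pn nl).
  have [_ [_ _ fp _]] := pP l.+1.
  apply: leq_trans (f_le _ _ (ltnW nl)) _; apply: (leq_trans fp); apply: ltnW.
  apply: leq_trans (ph _ (leqW ql)) (hS _ _ _).
  exact: ltnW (leq_trans (ph _ ql) (hS _ _ ln)).
have [a [Aa la _ xa]] := pP l.
have lp := interval_id_leq p_lt.
exists a.
  have := lp l.+1; rewrite -la.
  have [->|a0] := posnP a; first by rewrite trunc_log0; lia.
  have := trunc_logP (leqnn 2) a0; have := ltn_expl (trunc_log 2 a) (leqnn 2).
  lia.
split=> //.
have [k kP] := ex_interval h_lt h0 (p l.+1).
have lk : p l <= k.
  by case/andP: kP => _; exact: (interval_index_leq h_lt (leqnn _) hl).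
exists k; first by rewrite la.
exists x; first by apply: Cx; have := lp l; lia.
by move=> i ki; apply: xa; rewrite -la; lia.
Qed.

Definition prefixes (m : nat) (K : set cantor_space) : {set m.-tuple bool} :=
  [set s : m.-tuple bool |
    `[< exists2 y, K y & forall i : 'I_m, y i = tnth s i >]]%SET.

(** Of the factor [2 ^ p.*2], one [2 ^ p] pays for the free low digits and the other makes the
    relative size in dyadic intervals tend to zero. *)
Lemma density_zero_tree_set (R : realType) (h : nat -> nat)
    (C : nat -> set cantor_space) :
  h 0 = 0 -> (forall k, h k < h k.+1) ->
  (forall p m, h p <= m -> #|prefixes m (C p)| * 2 ^ p.*2 <= 2 ^ m) ->
  density_zero R (tree_set h C).
Proof.
move=> h0 h_lt hP; apply: density_zero_dyadic => p; exists (h p) => m pm.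
have [q /andP[qm mq]] := ex_interval h_lt h0 m.
have pq : p <= q by exact: (interval_index_leq h_lt (leqnn m) pm mq).
suff cnt_le : count (fun i => `[< tree_set h C i >]) (iota (2 ^ m) (2 ^ m)) <=
    2 ^ q * #|prefixes m (C q)|.
  apply: leq_trans (hP q m qm).
  apply: (@leq_trans (2 ^ q * #|prefixes m (C q)| * 2 ^ q)).
    by apply: leq_mul => //; rewrite leq_exp2l.
  by rewrite -addnn expnD mulnAC mulnC.
have log n : n \in iota (2 ^ m) (2 ^ m) -> trunc_log 2 n = m.
  by rewrite mem_iota => nm; apply: trunc_log_eq => //; rewrite expnS; lia.
have /boolp.choice[y yP] n : exists y : cantor_space,
    trunc_log 2 n = m -> tree_set h C n ->
    C q y /\ forall i, q <= i < m -> y i = bit n i.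
  have [nm|] := pselect (trunc_log 2 n = m); last by exists (fun=> false).
  have [[k kn [y Cy yn]]|] := pselect (tree_set h C n); last by exists (fun=> false).
  exists y => _ _; rewrite nm in kn yn; have qmq : h q <= m < h q.+1 by rewrite qm.
  by rewrite (interval_index_inj h_lt qmq kn).
have q0 : 0 < 2 ^ q by rewrite expn_gt0.
(* The low [q] digits and a matching prefix determine [n] modulo [2 ^ m], hence [n] itself between
   [2 ^ m] and [2 ^ m.+1]. *)
pose g n := (Ordinal (ltn_pmod n q0), [tuple y n i | i < m]).
rewrite -size_filter -(size_map g) -[X in X * _]card_ord -cardsT -cardsX cardE.
apply: uniq_leq_size => [|u /mapP[n + ->]]; last first.
  rewrite mem_filter mem_enum => /andP[/asboolP Bn /log nm].
  rewrite inE; apply/andP; split; rewrite inE//.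
  apply/asboolP; exists (y n); first by have [] := yP n nm Bn.
  by move=> i; rewrite tnth_mktuple.
rewrite map_inj_in_uniq ?filter_uniq ?iota_uniq// => a b.
rewrite !mem_filter => /andP[/asboolP Ba am] /andP[/asboolP Bb bm] [ab yab].
have [_ ya] := yP a (log a am) Ba; have [_ yb] := yP b (log b bm) Bb.
have mod2 c : c \in iota (2 ^ m) (2 ^ m) -> c %% 2 ^ m = c - 2 ^ m.
  rewrite mem_iota => cm; rewrite -[in LHS](@subnKC (2 ^ m) c) ?modnDl; last by lia.
  by rewrite modn_small//; lia.
have : a = b %[mod 2 ^ m].
  apply: (bit_eq_mod _ ab) => [|i /andP[qi im]].
    by rewrite (leq_trans _ qm)// interval_id_leq.
  rewrite -ya ?qi// -yb ?qi//.
  have /val_inj/(congr1 (fun t => tnth t (Ordinal im))) :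
    val [tuple y a i | i < m] = val [tuple y b i | i < m] by [].
  by rewrite !tnth_mktuple.
rewrite !mod2//; move: am bm; rewrite !mem_iota; lia.
Qed.

(** * Null subsets of the Cantor space *)

Lemma prefixesP (m : nat) (K : set cantor_space) (s : m.-tuple bool) :
  reflect (exists2 y, K y & forall i, i < m -> y i = nth false s i)
    (s \in prefixes m K).
Proof.
rewrite inE; apply: (iffP (asboolP _)) => -[y Ky ys]; exists y => //.
  by move=> i im; rewrite (ys (Ordinal im)) (tnth_nth false).
by move=> i; rewrite (tnth_nth false) ys.
Qed.

Lemma card_prefixes_leq (m : nat) (K : set cantor_space) :
  #|prefixes m K| <= 2 ^ m.
Proof. by rewrite (leq_trans (max_card _))// card_tuple card_bool. Qed.

Lemma prefixesU (m n : nat) (K : set cantor_space) (C : nat -> set cantor_space) :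
  (forall y, K y -> exists2 i, i < n & C i y) ->
  #|prefixes m K| <= \sum_(i < n) #|prefixes m (C i)|.
Proof.
move=> KC; apply: (@leq_trans #|\bigcup_(i < n) prefixes m (C i)|%SET).
  apply: subset_leq_card; apply/fintype.subsetP => s /prefixesP[y /KC[i ni Cy] ys].
  by apply/finset.bigcupP; exists (Ordinal ni) => //; apply/prefixesP; exists y.
elim/big_ind2: _ => [|A a B b Aa Bb|//]; first by rewrite cards0.
by rewrite (leq_trans (leq_card_setU _ _))// leq_add.
Qed.

Lemma card_prefixesD (q b : nat) (K K' : set cantor_space)
    (S : {set b.-tuple bool}) :
  (forall y, K' y -> K y /\ [tuple y (q + i) | i < b] \in S) ->
  #|prefixes (q + b) K'| <= #|prefixes q K| * #|S|.
Proof.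
move=> K'P; pose split (t : (q + b).-tuple bool) :=
  ([tuple nth false t i | i < q], [tuple nth false t (q + i) | i < b]).
rewrite -(@card_in_imset _ _ split).
  rewrite -cardsX; apply: subset_leq_card; apply/fintype.subsetP => u.
  move=> /imsetP[t /prefixesP[y /K'P[Ky yS] yt] ->].
  rewrite inE; apply/andP; split=> /=.
    apply/prefixesP; exists y => // i iq.
    by rewrite -[i]/(val (Ordinal iq)) -tnth_nth tnth_mktuple yt// ltn_addr.
  rewrite (_ : [tuple _ | _ < b] = [tuple y (q + i) | i < b])//.
  by apply: eq_mktuple => i; rewrite yt// ltn_add2l.
move=> t t' _ _ [tt' tt2]; apply: eq_from_tnth => i.
rewrite !(tnth_nth false); have [iq|qi] := ltnP i q.
  have /val_inj/(congr1 (fun s => tnth s (Ordinal iq))) :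
    val [tuple nth false t i | i < q] = val [tuple nth false t' i | i < q] by [].
  by rewrite !tnth_mktuple.
have ib : i - q < b by rewrite ltn_subLR.
have /val_inj/(congr1 (fun s => tnth s (Ordinal ib))) :
  val [tuple nth false t (q + i) | i < b] =
  val [tuple nth false t' (q + i) | i < b] by [].
by rewrite !tnth_mktuple /= subnKC.
Qed.

(** Digits from [e] to [q] are free, and the window of length [b] must avoid one word. *)
Lemma card_prefixes_window (e q b : nat) (u : nat -> bool)
    (K K' : set cantor_space) : e <= q ->
  (forall y, K' y -> K y /\ exists2 i, i < b & y (q + i) <> u i) ->
  #|prefixes (q + b) K'| <= #|prefixes e K| * (2 ^ (q - e) * (2 ^ b - 1)).
Proof.
move=> eq K'P; rewrite mulnA.
apply: (@leq_trans (#|prefixes q K| * (2 ^ b - 1))).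
  apply: leq_trans (@card_prefixesD q b K K' [set~ [tuple u i | i < b]]%SET _) _.
    move=> y /K'P[Ky [i ib yu]]; split=> //; rewrite !inE.
    apply/eqP => /(congr1 (fun s => tnth s (Ordinal ib))).
    by rewrite !tnth_mktuple.
  by rewrite leq_mul2l cardsC1 card_tuple card_bool subn1 leqnn orbT.
have := @card_prefixesD e (q - e) K K [set: (q - e).-tuple bool]%SET.
rewrite subnKC// cardsT card_tuple card_bool => ext.
by rewrite leq_mul2r ext ?orbT// => y Ky; split=> //; rewrite inE.
Qed.

(** Each of the [T] disjoint windows leaves a fraction [1 - 2^-b], at most [1 - 2^-B], of the words;
    the product is stated without division. *)
Lemma card_prefixes_windows (T B : nat) (q b : nat -> nat)
    (u : nat -> nat -> bool) (K : set cantor_space) :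
  (forall i, i < T -> b i <= B) ->
  (forall i, i.+1 < T -> q i + b i <= q i.+1) ->
  (forall y, K y -> forall i, i < T -> exists2 j, j < b i & y (q i + j) <> u i j) ->
  exists m, #|prefixes m K| * (2 ^ B) ^ T <= 2 ^ m * (2 ^ B - 1) ^ T.
Proof.
(* [e i] is the end of the window before the [i]-th, or 0 for the first. *)
move=> bB qb Ku; pose e i := if i is i'.+1 then q i' + b i' else 0.
pose V k : set cantor_space :=
  [set y | forall i, i < k -> exists2 j, j < b i & y (q i + j) <> u i j].
have VP k : k <= T ->
    #|prefixes (e k) (V k)| * (2 ^ B) ^ k <= 2 ^ e k * (2 ^ B - 1) ^ k.
  elim: k => [_|k IH kT]; first by rewrite !expn0 !muln1 card_prefixes_leq.
  have eq : e k <= q k by case: k {IH} kT => // k kT; exact: qb.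
  have step : #|prefixes (e k.+1) (V k.+1)| <=
      #|prefixes (e k) (V k)| * (2 ^ (q k - e k) * (2 ^ b k - 1)).
    apply: (@card_prefixes_window _ _ _ (u k)) => // y Vy.
    by split=> [i ik|]; [exact/Vy/ltnW|exact: Vy].
  have {}IH := IH (ltnW kT).
  have bBk : (2 ^ b k - 1) * 2 ^ B <= 2 ^ b k * (2 ^ B - 1).
    have := leq_pexp2l (ltn0Sn 1) (bB k kT); nia.
  apply: leq_trans (leq_mul step (leqnn _)) _.
  rewrite !expnS.
  rewrite [X in X <= _](_ : _ = (#|prefixes (e k) (V k)| * (2 ^ B) ^ k) *
    (2 ^ (q k - e k) * ((2 ^ b k - 1) * 2 ^ B))); last by lia.
  apply: leq_trans (leq_mul IH (leq_mul (leqnn _) bBk)) _.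
  rewrite [X in _ <= X * _]/= expnD -{2}(subnKC eq) expnD.
  by rewrite leq_eqVlt; apply/orP; left; apply/eqP; lia.
exists (e T); apply: leq_trans (VP T (leqnn T)); rewrite leq_mul2r.
apply/orP; right; apply: subset_leq_card; apply/fintype.subsetP => s.
by move=> /prefixesP[y /Ku Ky ys]; apply/prefixesP; exists y.
Qed.

(** This is [(1 + 1/r)^(r+1) >= 2] for positive [r], from Bernoulli's inequality. *)
Lemma leq_double_exp (r : nat) : 2 * r ^ r.+1 <= r.+1 ^ r.+1.
Proof.
have bern k : r ^ k * (r + k) <= r.+1 ^ k * r.
  elim: k => [|k IH]; first by rewrite !expn0 !mul1n addn0.
  by rewrite !expnS; nia.
have := bern r.+1; case: r {bern} => [|r]; first by [].
by move=> H; rewrite -(@leq_pmul2r r.+1)//; apply: leq_trans H; nia.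
Qed.

(** Every [2 ^ B] windows at least halve the fraction of words left. *)
Lemma card_prefixes_windows_small (n B : nat) (q b : nat -> nat)
    (u : nat -> nat -> bool) (K : set cantor_space) : 0 < B ->
  (forall i, i < 2 ^ B * n -> b i <= B) ->
  (forall i, i.+1 < 2 ^ B * n -> q i + b i <= q i.+1) ->
  (forall y, K y -> forall i, i < 2 ^ B * n ->
    exists2 j, j < b i & y (q i + j) <> u i j) ->
  exists m, #|prefixes m K| * 2 ^ n <= 2 ^ m.
Proof.
move=> B0 bB qb Ku; have [m mP] := card_prefixes_windows bB qb Ku.
exists m; have := leq_double_exp (2 ^ B - 1).
have r0 : 0 < 2 ^ B - 1 by rewrite subn_gt0 -[X in X < _](expn0 2) ltn_exp2l.
rewrite subn1 prednK ?expn_gt0// -subn1 => dbl.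
have {}dbl : 2 ^ n * (2 ^ B - 1) ^ (2 ^ B * n) <= (2 ^ B) ^ (2 ^ B * n).
  rewrite !(expnM _ (2 ^ B)) -expnMn.
  by have [->|n0] := posnP n; rewrite ?expn0// leq_exp2r.
rewrite -(@leq_pmul2r ((2 ^ B - 1) ^ (2 ^ B * n))) ?expn_gt0 ?r0//.
by apply: leq_trans mP; rewrite -mulnA leq_mul.
Qed.

(** * Topology and measure through prefixes *)

Lemma open_finite_support (L : nat) (U : set cantor_space) :
  (forall x y, U x -> (forall i, i < L -> x i = y i) -> U y) -> open U.
Proof.
move=> UP; rewrite openE => x Ux.
suff : \forall y \near x, forall i, i < L -> x i = y i.
  by apply: filterS => y; exact: UP.
elim: L {UP} => [|L IH]; first by apply: filterE => y i; rewrite ltn0.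
have xL : \forall y \near x, x L = y L.
  have := @proj_continuous nat (fun=> bool) L x [set b | x L = b].
  by apply; apply: filterS (discrete_set1 _) => b /= ->.
apply: filterS2 IH xL => y xy xyL i.
by rewrite ltnS leq_eqVlt => /predU1P[->//|]; exact: xy.
Qed.

Lemma open_cylinder (s : seq bool) : open (cylinder s).
Proof.
apply: (@open_finite_support (size s)) => x y xs xy i si.
by rewrite -xy// xs.
Qed.

Lemma card_tuples_prefix (m : nat) (s : seq bool) : size s <= m ->
  #|[set t : m.-tuple bool | take (size s) t == s]%SET| <= 2 ^ (m - size s).
Proof.
move=> sm; rewrite -(@card_in_imset _ _
  (fun t : m.-tuple bool => [tuple of drop (size s) t])).
  by rewrite (leq_trans (max_card _))// card_tuple card_bool.
move=> t t'; rewrite !inE => /eqP ts /eqP t's /(congr1 val) /= tt'.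
apply: val_inj; rewrite /= -(cat_take_drop (size s) t) ts tt'.
by rewrite -{1}t's cat_take_drop.
Qed.

Section Measure.
Variable R : realType.
Local Open Scope ring_scope.

(** By compactness finitely many cylinders of total measure at most [1/c] cover [K]; once [m]
    reaches their lengths, counting extensions bounds the prefixes. *)
Lemma null_prefixes (K : set cantor_space) (c : nat) :
  closed K -> cantor_measure R K = 0%E ->
  exists m0, forall m, (m0 <= m)%N -> (#|prefixes m K| * c <= 2 ^ m)%N.
Proof.
move=> Kcl K0; have [->|c0] := posnP c.
  by exists 0%N => m _; rewrite muln0.
have : (cantor_measure R K < (c%:R^-1)%:E)%E by rewrite K0 lte_fin invr_gt0 ltr0n.
move=> /ereal_inf_lt[_ [s Ks <-] slt].
have Kco : cover_compact K.
  by rewrite -compact_cover; exact: subclosed_compact cantor_space_compact _.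
have [D _ KD] := Kco _ setT (fun k => cylinder (s k)) (fun k _ => open_cylinder _) Ks.
have [n nD] := (finite_natP [set` D]).1 (finite_fset D).
have {}KD y : K y -> exists2 k, (k < n)%N & cylinder (s k) y.
  by move=> /KD[k kD ys]; exists k => //; exact: nD.
have le_c : \sum_(k < n) 2 ^- size (s k) <= c%:R^-1 :> R.
  rewrite -lee_fin -sumEFin -(big_mkord xpredT (fun k => (2 ^- size (s k))%:E)).
  apply: le_trans (ltW slt); apply: nneseries_lim_ge => k _ _.
  by rewrite lee_fin invr_ge0 exprn_ge0.
exists (\max_(k < n) size (s k))%N => m nm.
have sm (k : 'I_n) : (size (s k) <= m)%N.
  exact: leq_trans (leq_bigmax k) nm.
rewrite -(@ler_nat R) natrM -ler_pdivlMr ?ltr0n//.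
apply: (@le_trans _ _ (\sum_(k < n) 2 ^+ m * 2 ^- size (s k))); last first.
  by rewrite -mulr_sumr natrX; apply: ler_wpM2l.
apply: (@le_trans _ _ (\sum_(k < n) (2 ^ (m - size (s k)))%N%:R)); last first.
  apply: ler_sum => k _; rewrite natrX expfB_cond//.
  by rewrite pnatr_eq0 add0n; exact: sm.
rewrite -natr_sum ler_nat; apply: leq_trans (prefixesU m KD) _.
apply: leq_sum => k _; apply: leq_trans (card_tuples_prefix (sm k)).
apply: subset_leq_card; apply/fintype.subsetP => t /prefixesP[y ys yt].
rewrite inE; apply/eqP/(@eq_from_nth _ false).
  by rewrite size_takel// size_tuple.
rewrite size_takel ?size_tuple// => i si.
by rewrite nth_take// -yt ?ys// (leq_trans si).
Qed.

Lemma cantor_measure_le (K : set cantor_space) (m j : nat) :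
  (cantor_measure R K <= (#|prefixes m K|%:R * 2 ^- m + 2 * 2 ^- j)%:E)%E.
Proof.
set N := #|prefixes m K|.
(* A cover is an infinite sequence, so the list of prefixes is padded by words of total measure at
   most [2 * 2^-j]. *)
pose s k := if (k < N)%N then
  val (nth (nseq_tuple m false) (enum (prefixes m K)) k) else nseq (j + k) false.
apply: (@le_trans _ _ (\sum_(0 <= k <oo) (2 ^- size (s k))%:E)%E).
  apply: ereal_inf_lbound; exists s => // y Ky.
  have yK : [tuple y i | i < m] \in prefixes m K.
    by rewrite inE; apply/asboolP; exists y => // i; rewrite tnth_mktuple.
  have idx : (index [tuple y i | i < m] (enum (prefixes m K)) < N)%N.
    by rewrite /N cardE index_mem mem_enum.
  exists (index [tuple y i | i < m] (enum (prefixes m K))) => // i.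
  rewrite /s idx nth_index ?mem_enum// size_tuple => im.
  by rewrite -(tnth_nth false _ (Ordinal im)) tnth_mktuple.
apply: lime_le.
  by apply: is_cvg_nneseries => k _ _; rewrite lee_fin invr_ge0 exprn_ge0.
apply: nearW => n; rewrite sumEFin lee_fin.
have ub : \sum_(0 <= k < n) 2 ^- size (s k) <=
    (minn n N)%:R * 2 ^- m + 2 * 2 ^- j - 2 * 2 ^- (j + n) :> R.
  elim: n => [|n IH]; first by rewrite big_geq// min0n mul0r add0r addn0 subrr.
  rewrite big_nat_recr//=; apply: le_trans (lerD IH (lexx _)) _.
  have pos : 0 < 2 ^- (j + n.+1) :> R by rewrite invr_gt0 exprn_gt0.
  have E : 2 ^- (j + n) = 2 * 2 ^- (j + n.+1) :> R.
    by rewrite addnS exprS invfM mulrA mulfV ?mul1r// pnatr_eq0.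
  rewrite /s; case: ltnP => nN.
    rewrite size_tuple (minn_idPl nN) -natr1 E; nra.
  rewrite size_nseq (minn_idPr (leqW nN)) E; nra.
apply: le_trans ub _.
have : (minn n N)%:R <= N%:R :> R by rewrite ler_nat geq_minr.
have : 0 < 2 ^- (j + n) :> R by rewrite invr_gt0 exprn_gt0.
have : 0 < 2 ^- m :> R by rewrite invr_gt0 exprn_gt0.
nra.
Qed.

Lemma prefixes_null (K : set cantor_space) :
  (forall c, exists m, (#|prefixes m K| * 2 ^ c <= 2 ^ m)%N) ->
  cantor_measure R K = 0%E.
Proof.
move=> Ksmall; apply/eqP; rewrite eq_le; apply/andP; split; last first.
  apply: le_ereal_inf_tmp => _ [s _ <-]; apply: nneseries_ge0 => k _ _.
  by rewrite lee_fin invr_ge0 exprn_ge0.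
apply/lee_addgt0Pr => e e0; rewrite add0e.
(* The 3 is one [2^-c] for the prefixes and two for the padding. *)
have [c _ ce] : \forall c \near \oo, (3 / e <= c%:R :> R)%R by exact: nbhs_infty_ger.
have [m mP] := Ksmall c.
apply: le_trans (cantor_measure_le K m c) _; rewrite lee_fin.
have c2 : 3 / e <= 2 ^+ c :> R.
  apply: le_trans (ce c (leqnn c)) _; rewrite -natrX ler_nat.
  exact/ltnW/ltn_expl.
have {}mP : #|prefixes m K|%:R * 2 ^- m <= 2 ^- c :> R.
  rewrite ler_pdivrMr ?exprn_gt0// mulrC ler_pdivlMr ?exprn_gt0//.
  by rewrite -!natrX -natrM ler_nat.
have : 3 * 2 ^- c <= e.
  by rewrite ler_pdivrMr ?exprn_gt0// mulrC -ler_pdivrMr.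
lra.
Qed.
End Measure.

(** * The ideal E *)

Section IdealE.
Variable R : realType.

Lemma idealE_closed_null (K : set cantor_space) :
  closed K -> cantor_measure R K = 0%E -> idealE R K.
Proof. by move=> Kcl K0; apply: sub_gen_smallest. Qed.

Lemma sigma_ideal_idealE : sigma_ideal (idealE R).
Proof.
split=> [M [[M0 _ _] _]//|A B AB EB M SM|A EA M SM].
  by have [[_ Msub _] _] := SM; apply: Msub AB _; exact: EB.
by have [[_ _ Mcup] _] := SM; apply: Mcup => n; exact: EA.
Qed.

(** Sets covered by countably many closed null sets form a sigma-ideal containing the generators. *)
Lemma idealE_sub_closed_null (N : set cantor_space) : idealE R N ->
  exists2 C : nat -> set cantor_space,
    forall i, closed (C i) /\ cantor_measure R (C i) = 0%E & N `<=` \bigcup_i C i.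
Proof.
pose P (A : set cantor_space) := exists2 C : nat -> set cantor_space,
  forall i, closed (C i) /\ cantor_measure R (C i) = 0%E & A `<=` \bigcup_i C i.
apply: (@smallest_sub _ (@sigma_ideal cantor_space) _ P) => [|A Acl]; last first.
  by exists (fun=> A) => // x Ax; exists 0.
have null0 : closed (set0 : set cantor_space) /\ cantor_measure R set0 = 0%E.
  split; first exact: closed0.
  apply: prefixes_null => c; exists 0; rewrite (_ : prefixes 0 set0 = finset.set0).
    by rewrite cards0.
  by apply/setP => s; rewrite finset.in_set0; apply/prefixesP => -[].
split=> [|A B AB [C CP BC]|A PA].
- by exists (fun=> set0) => //; exact: sub0set.
- by exists C => //; exact: subset_trans AB BC.
have /boolp.choice[C CP] n : exists C : nat -> set cantor_space,
    (forall i, closed (C i) /\ cantor_measure R (C i) = 0%E) /\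
    A n `<=` \bigcup_i C i.
  by have [C] := PA n; exists C.
exists (fun k => if choice.unpickle k is Some (n, i) then C n i else set0).
  by move=> k; case: choice.unpickle => [[n i]|//]; exact: (CP n).1.
move=> x [n _ Anx]; have [i _ Cx] := (CP n).2 x Anx.
by exists (choice.pickle (n, i)) => //; rewrite choice.pickleK.
Qed.

Lemma idealE_set1 (x : cantor_space) : idealE R [set x].
Proof.
apply: idealE_closed_null.
  exact/accessible_closed_set1/hausdorff_accessible/cantor_space_hausdorff.
apply: prefixes_null => c; exists c; rewrite -[leqRHS]mul1n leq_mul2r.
apply/orP; right; rewrite -(cards1 [tuple x i | i < c]).
apply: subset_leq_card; apply/fintype.subsetP => s /prefixesP[_ -> xs].
rewrite inE; apply/eqP/eq_from_tnth => i.
by rewrite tnth_mktuple xs// (tnth_nth false).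
Qed.

Lemma idealE_capture (N : set cantor_space) : idealE R N ->
  exists g B, density_zero R B /\
    forall A f x p, {homo f : m n / m <= n} -> is_code A f x p ->
      ~ eventually_le f g -> N x -> infinite_set (A `&` B).
Proof.
move=> /idealE_sub_closed_null[C CP NC].
have /boolp.choice[L LP] u : exists m0, forall m, m0 <= m ->
    #|prefixes m (C u.1)| * u.2 <= 2 ^ m.
  by have [Ccl C0] := CP u.1; exact: null_prefixes Ccl C0.
pose T p : set cantor_space := [set y | exists2 i, i < p.+1 & C i y].
(* The factor [p.+1] pays for the union of [p.+1] closed sets in [T p]. *)
pose H p := \max_(i < p.+1) L (val i, p.+1 * 2 ^ p.*2).
pose h := fix h p := if p is p'.+1 then (maxn (h p') (H p)).+1 else 0.
have hS p : h p.+1 = (maxn (h p) (H p.+1)).+1 by [].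
have h_lt p : h p < h p.+1 by rewrite hS ltnS leq_maxl.
have hP p m : h p <= m -> #|prefixes m (T p)| * 2 ^ p.*2 <= 2 ^ m.
  case: p => [_|p hm]; first by rewrite muln1 card_prefixes_leq.
  have Hm : H p.+1 <= m.
    by apply: leq_trans hm; rewrite hS leqW// leq_maxr.
  rewrite -(@leq_pmul2l p.+2)// mulnCA.
  have TC y : T p.+1 y -> exists2 i, i < p.+2 & C i y by [].
  apply: leq_trans (leq_mul (prefixesU m TC) (leqnn _)) _.
  rewrite big_distrl /= -[X in _ <= X * _](card_ord p.+2) -sum_nat_const.
  apply: leq_sum => i _; apply: (LP (val i, p.+2 * 2 ^ p.+1.*2)).
  by apply: leq_trans Hm; exact: (@leq_bigmax _ (fun i : 'I_p.+2 => _) i).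
exists (h \o h), (tree_set h T); split; first exact: density_zero_tree_set.
move=> A f x p f_le code fh /NC[i _ Cix].
apply: (@tree_set_capture h T A f x p i) => // k ik.
by exists i.
Qed.

(** Where [f] exceeds [g], many sparse elements of [C] fall into low levels. Missing all of them
    means avoiding one short word in each of many disjoint windows. *)
Lemma guess_set_capture (C : set nat) : infinite_set C ->
  exists g, forall f, {homo f : m n / m <= n} -> ~ eventually_le f g ->
    idealE R [set w : cantor_space | finite_set (C `&` guess_set f w)].
Proof.
move=> /infinite_natP Cinf.
(* The jumps of the sequence below exceed block length plus window length, so the windows are
   disjoint. *)
have /boolp.choice[nxt nxtP] q : exists a, C a /\ q <= a.
  by have [a] := Cinf q; exists a.
pose step a := nxt (a.*2 + 2 ^ a.+1 + 1).
pose a n i := iter i step (nxt n).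
have aS n i : (a n i).*2 + 2 ^ (a n i).+1 + 1 <= a n i.+1.
  by have [] := nxtP ((a n i).*2 + 2 ^ (a n i).+1 + 1).
have a_lt n i : a n i < a n i.+1 by apply: leq_trans (aS n i); rewrite -addnn; lia.
have aC n i : C (a n i).
  case: i => [|i]; first by have [] := nxtP n.
  by have [] := nxtP ((a n i).*2 + 2 ^ (a n i).+1 + 1).
have a_ge n i : n <= a n i.
  by apply: leq_trans (interval_leq (a_lt n) (leq0n i)); have [] := nxtP n.
(* Windows have length at most [n.+1], so [2 ^ n.+1 * n] of them bring the measure down to
   [2^-n]. *)
exists (fun n => a n (2 ^ n.+1 * n)) => f f_le fg.
pose K M : set cantor_space :=
  [set w | forall n, C n -> M <= n -> ~ guess_set f w n].
have [_ Esub Ecup] := sigma_ideal_idealE.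
apply: (Esub _ (\bigcup_M K M)).
  move=> w /finite_natP[M wM]; exists M => // n Cn Mn wn.
  by have := wM n (conj Cn wn); rewrite ltnNge Mn.
apply: Ecup => M; apply: idealE_closed_null.
  rewrite -openC (_ : ~` K M = \bigcup_(n in [set n | C n /\ M <= n])
      [set w : cantor_space | guess_set f w n]).
    apply: bigcup_open => n _; case: (ex_interval (mark_lt f) (erefl _) n) => k kn.
    apply: (@open_finite_support (2 ^ k * (n %/ 2 ^ k) + k)).
    move=> x y [k' k'n xn] xy; exists k' => // i ik'; rewrite -xn// xy//.
    by rewrite -(interval_index_inj (mark_lt f) k'n kn) ltn_add2l.
  apply/seteqP; split=> [w nKw|w [n [Cn Mn] wn] Kw]; last exact: Kw Cn Mn wn.
  apply: contrapT => nw; apply: nKw => n Cn Mn wn; apply: nw.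
  by exists n.
apply: prefixes_null => c.
(* Here [c] gives the wanted smallness and [M] puts every [a n i] in the range where [K M] forbids
   guesses. *)
have [n cMn gf] : exists2 n, c + M <= n & a n (2 ^ n.+1 * n) < f n.
  apply: contrapT => nex; apply: fg; exists (c + M) => n cMn.
  by rewrite leqNgt; apply/negP => ?; apply: nex; exists n.
have [k /andP[kn nk]] := ex_interval (mark_lt f) (erefl _) n.
have /boolp.choice[l lP] i : exists l, mark f l <= a n i < mark f l.+1.
  exact: ex_interval (mark_lt f) (erefl _) _.
have lk i : i < 2 ^ n.+1 * n -> l i <= k.+1.
  move=> iT; have /andP[li _] := lP i.
  apply: (interval_index_leq (mark_lt f) (leqnn _) li).
  apply: leq_ltn_trans (interval_leq (a_lt n) (ltnW iT)) _.
  apply: ltn_trans gf _; apply: leq_ltn_trans (f_le _ _ (ltnW nk)) _.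
  exact: leq_ltn_trans (leq_addl _ _) (mark_next f k.+1).
have kn' : k <= n by exact: leq_trans (leq_mark f k) kn.
have [||||m mP] := @card_prefixes_windows_small n n.+1
  (fun i => 2 ^ l i * (a n i %/ 2 ^ l i)) l (fun i => bit (a n i)) (K M).
- by [].
- by move=> i /lk; lia.
- move=> i iT; have := aS n i; have := a_ge n i.
  have l1 := lk _ (ltnW iT); have l2 := lk _ iT.
  have e2 : 2 ^ l i.+1 <= 2 ^ (a n i).+1.
    by rewrite leq_exp2l//; have := a_ge n i; lia.
  have := ltn_pmod (a n i.+1) (expn_gt0 2 (l i.+1)).
  have := divn_eq (a n i.+1) (2 ^ l i.+1).
  have := leq_trunc_div (a n i) (2 ^ l i).
  by rewrite ![2 ^ _ * (_ %/ _)]mulnC -addnn; lia.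
- move=> y Ky i _; apply: contrapT => nex.
  apply: (Ky (a n i) (aC n i)); first by have := a_ge n i; lia.
  exists (l i) => // j jl; apply: contrapT => yj; apply: nex.
  by exists j.
exists m; apply: leq_trans mP; rewrite leq_mul2l leq_exp2l//.
by apply/orP; right; lia.
Qed.

(** If [g A] is eventually below [h], then [residue_set h] catches [A]; otherwise the set obtained
    from the prefixes does. *)
Lemma ex_tukey_idealE : exists phi : set nat -> cantor_space,
  forall N, idealE R N -> exists2 B, density_zero R B &
    forall A, infinite_set A -> N (phi A) -> infinite_set (A `&` B).
Proof.
have [g gP] := ex_residue_bound.
have /boolp.choice[phi phiP] A : exists x : cantor_space, infinite_set A ->
    exists p, is_code A (g A) x p.
  have [Ainf|] := pselect (infinite_set A); last by exists (fun=> false).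
  by have [x [p xp]] := ex_code (g A) Ainf; exists x => _; exists p.
exists phi => N /idealE_capture[h [B [ZB BP]]].
exists (B `|` residue_set h).
  by apply: density_zeroU => //; exact: density_zero_residue_set.
move=> A Ainf NA; have [g_le gA] := gP A Ainf; have [p code] := phiP A Ainf.
have [/gA|ngh] := pselect (eventually_le (g A) h).
  by apply: sub_infinite_set; apply: setIS; exact: subsetUr.
apply: sub_infinite_set (BP A (g A) (phi A) p g_le code ngh NA).
by apply: setIS; exact: subsetUl.
Qed.

End IdealE.

(** * The cardinal inequalities *)

(** For finite [F] the maximum of the bounds [g A] would give one residue set meeting every member
    infinitely often. *)
Lemma infinite_density_zero_dual (R : realType) (F : set (set nat)) :
  F `<=` [set A | infinite_set A] ->
  (forall B, density_zero R B -> exists2 A, F A & finite_set (A `&` B)) ->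
  infinite_set F.
Proof.
move=> Finf Fdual /finite_seqP[s Fs].
have [g gP] := ex_residue_bound.
have [A FA] := Fdual _ (@density_zero_residue_set R (fun n => \max_(A <- s) g A n)).
apply: (gP A (Finf _ FA)).2.
exists 0 => n _; apply: (@leq_bigmax_seq _ s xpredT (fun A => g A n)) => //.
by move: FA; rewrite Fs.
Qed.

Theorem theorem4p58 (R : realType) :
  [/\ non (idealE R) #<= nonstar (density_zero R),
      covstar (density_zero R) #<= cov (idealE R) &
      covstar (density_zero R) #<= nonstar (density_zero R)].
Proof.
have [phi phiP] := ex_tukey_idealE R.
have [|[Finf Fdual] _] := @min_cardP _ [set F : set (set nat) |
    F `<=` [set A | infinite_set A] /\
    forall B, density_zero R B -> exists2 A, F A & finite_set (A `&` B)].
  exists [set A | infinite_set A]; split=> // B ZB; exists (~` B).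
    exact: density_zero_setC_infinite ZB.
  by rewrite setICl; exact: finite_set0.
rewrite -/(nonstar (density_zero R)) in Finf Fdual.
set F := nonstar _ in Finf Fdual *.
have phiF : ~ idealE R (phi @` F).
  move=> /phiP[B ZB BP]; have [A FA] := Fdual B ZB.
  by apply: BP; [exact: Finf|exists A].
have covstar_le (G : set (set nat)) : G `<=` density_zero R ->
    (forall B, infinite_set B -> exists2 A, G A & infinite_set (A `&` B)) ->
    covstar (density_zero R) #<= G.
  move=> GZ Gcov; have [|_] := @min_cardP _ [set G : set (set nat) |
      G `<=` density_zero R /\
      forall B, infinite_set B -> exists2 A, G A & infinite_set (A `&` B)].
    by exists G.
  exact.
split.
- have [|_ min_le] := @min_cardP _ [set X | ~ idealE R X].
    by exists (phi @` F).
  exact: card_le_trans (min_le _ phiF) (card_image_le _ _).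
- have [|[GE GT] _] := @min_cardP _
      [set G | G `<=` idealE R /\ \bigcup_(A in G) A = setT].
    (* Singletons show that the family defining [cov] is nonempty. *)
    exists (range set1); split=> [_ [x _ <-]|]; first exact: idealE_set1.
    by apply/seteqP; split=> // x _; exists [set x] => //; exists x.
  rewrite -/(cov (idealE R)) in GE GT; set G := cov _ in GE GT *.
  have /boolp.choice[psi psiP] N : exists B, idealE R N -> density_zero R B /\
      forall A, infinite_set A -> N (phi A) -> infinite_set (A `&` B).
    have [/phiP[B ZB BP]|] := pselect (idealE R N); last by exists set0.
    by exists B.
  apply: card_le_trans (covstar_le (psi @` G) _ _) (card_image_le _ _).
    by move=> _ [N GN <-]; have [] := psiP N (GE _ GN).
  move=> A Ainf; have [N GN NA] : (\bigcup_(N in G) N) (phi A) by rewrite GT.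
  exists (psi N); first by exists N.
  by rewrite setIC; exact: (psiP N (GE _ GN)).2.
have [g gP] := ex_residue_bound.
pose D (u : set nat * set nat) := guess_set (g u.1) (phi u.2).
apply: card_le_trans (card_square (infinite_density_zero_dual Finf Fdual)).
apply: card_le_trans (covstar_le (D @` (F `*` F)) _ _) (card_image_le _ _).
  by move=> _ [u _ <-]; exact: density_zero_guess_set.
move=> C Cinf; have [h hP] := guess_set_capture R Cinf.
(* Being almost disjoint from [residue_set h], [A] has a bound [g A] not dominated by [h]. *)
have [A FA finA] := Fdual _ (@density_zero_residue_set R h).
have [g_le gA] := gP A (Finf _ FA).
have EN : idealE R [set w : cantor_space | finite_set (C `&` guess_set (g A) w)].
  by apply: hP g_le _ => /gA.
have [A' FA' wA'] : exists2 A', F A' &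
    infinite_set (C `&` guess_set (g A) (phi A')).
  apply: contrapT => nex; apply: phiF; have [_ Esub _] := sigma_ideal_idealE R.
  apply: Esub EN => _ [A' FA' <-] /=.
  by apply: contrapT => wA'; apply: nex; exists A'.
exists (D (A, A')); first by exists (A, A').
by rewrite setIC.
Qed.
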